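(* Let $\bar E,\bar A\in\{0,\times,\otimes\}^{n\times n}$, $\bar B\in\{0,\times,\otimes\}^{n\times p}$, $\bar C\in\{0,\times,\otimes\}^{m\times n}$ be selective structural matrices and $\bar K\in\{0,\times\}^{p\times m}$ an information pattern. Let $\mathcal P=\{1,\dots,p\}$ be the labels of the actuators, $\mathcal M=\{1,\dots,m\}$ the labels of the sensors, and for $i\in\mathcal P$ let $\mathcal J_i(\bar K)$ be the set of labels of all sensors fed to actuator $i$ with respect to $\bar K$, i.e. $\mathcal J_i(\bar K)=\{j\in\mathcal M:\bar K_{ij}=\times\}$. Then $(\bar E,\bar A,\bar B,\bar C;\bar K)$ has a selective strong structural fixed mode (with respect to $\bar K$) if and only if there exist $(E,A)\in([\bar E],[\bar A])^\star$, $B\in[\bar B]$, $C\in[\bar C]$ and $K\in[\bar K]$, a subset of actuators $\mathcal I\subseteq\mathcal P$ with corresponding subset of sensors $$\mathcal J(\mathcal I,\bar K)=\bigcup_{i\in\mathcal P\setminus\mathcal I}\mathcal J_i(\bar K)\subseteq\mathcal M,$$ and $\lambda\in\mathbb C$ such that $$\mathrm{rank}\begin{bmatrix}A-\lambda E& B(\mathcal I)\\ C(\mathcal J(\mathcal I,\bar K))&\mathbf 0\end{bmatrix}<n,$$ where $B(\mathcal I)$ is the submatrix of columns of $B$ with indices in $\mathcal I$, $C(\mathcal J)$ is the submatrix of rows of $C$ with indices in $\mathcal J$, and $\mathbf 0$ is a zero matrix of appropriate dimensions.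
   Context: $\bar X\in\{0,\times,\otimes\}^{a\times b}$ defines the class $[\bar X]$ of real $a\times b$ matrices $X$ with $X_{ij}=0$ if $\bar X_{ij}=0$, $X_{ij}\neq0$ if $\bar X_{ij}=\times$, $X_{ij}\in\mathbb R$ arbitrary if $\bar X_{ij}=\otimes$. For $\bar E,\bar A\in\{0,\times,\otimes\}^{n\times n}$, $([\bar E],[\bar A])^\star=\{(E,A)\in[\bar E]\times[\bar A]:\det(A-\lambda E)\not\equiv0\}$ (regular pencils). The underlying regular descriptor system is $E\dot x=Ax+Bu$, $y=Cx$, with static output feedback $u=-Ky$. An information pattern $\bar K\in\{0,\times\}^{p\times m}$ has $\bar K_{ij}=\times$ iff data of sensor $j$ is available to actuator $i$; a real matrix $K\in\mathbb R^{p\times m}$ satisfies $\bar K$ if $K_{ij}=0$ whenever $\bar K_{ij}=0$. $(\bar E,\bar A,\bar B,\bar C;\bar K)$ has a selective strong structural fixed mode (SSSFM) $\lambda\in\mathbb C$ with respect to $\bar K$ if there exist $(E,A)\in([\bar E],[\bar A])^\star$, $B\in[\bar B]$, $C\in[\bar C]$ such that $\mathrm{rank}(\lambda E-A-BKC)<n$ for all $K$ satisfying the information pattern $\bar K$. *)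

(* Defs.v *)
(* The real numbers are an arbitrary [R : realType], the complex numbers are [R[i]]. *)
From HB Require Import structures.
From mathcomp Require Import all_boot all_order all_algebra.
From mathcomp Require Import reals complex.

Set Implicit Arguments.
Unset Strict Implicit.
Unset Printing Implicit Defensive.
Import Order.TTheory GRing.Theory Num.Theory.
Local Open Scope ring_scope.

(* [Zero], [Cross], [OCross] stand for the symbols 0, \times, \otimes. *)
Inductive symbol : Set := Zero | Cross | OCross.

Definition symbol_eqb (s t : symbol) : bool :=
  match s, t with
  | Zero, Zero | Cross, Cross | OCross, OCross => true
  | _, _ => false
  end.

Lemma symbol_eqP : Equality.axiom symbol_eqb.
Proof. by case; case; constructor. Qed.

HB.instance Definition _ := hasDecEq.Build symbol symbol_eqP.

Definition entry_in (R : realType) (s : symbol) (x : R) : Prop :=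
  match s with
  | Zero => x = 0
  | Cross => x <> 0
  | OCross => True
  end.

Definition in_class (R : realType) (a b : nat)
    (Xbar : 'M[symbol]_(a, b)) (X : 'M[R]_(a, b)) : Prop :=
  forall i j, entry_in (Xbar i j) (X i j).

Definition regular_pencil (R : realType) (n : nat) (E A : 'M[R]_n) : Prop :=
  \det (map_mx polyC A - 'X *: map_mx polyC E) != 0.

(* ([Ebar], [Abar])^\star *)
Definition in_regular_class (R : realType) (n : nat)
    (Ebar Abar : 'M[symbol]_n) (E A : 'M[R]_n) : Prop :=
  [/\ in_class Ebar E, in_class Abar A & regular_pencil E A].

Definition information_pattern (p m : nat) (Kbar : 'M[symbol]_(p, m)) : Prop :=
  forall i j, Kbar i j \in [:: Zero; Cross].

(* Unlike [in_class Kbar K], this lets an entry of K at a \times vanish. *)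
Definition satisfies_pattern (R : realType) (p m : nat)
    (Kbar : 'M[symbol]_(p, m)) (K : 'M[R]_(p, m)) : Prop :=
  forall i j, Kbar i j = Zero -> K i j = 0.

Definition cplx (R : realType) (a b : nat) (X : 'M[R]_(a, b)) : 'M[R[i]]_(a, b) :=
  map_mx (real_complex R) X.

Definition is_SSSFM (R : realType) (n p m : nat)
    (Ebar Abar : 'M[symbol]_n) (Bbar : 'M[symbol]_(n, p))
    (Cbar : 'M[symbol]_(m, n)) (Kbar : 'M[symbol]_(p, m))
    (lambda : R[i]) : Prop :=
  exists (E A : 'M[R]_n) (B : 'M[R]_(n, p)) (C : 'M[R]_(m, n)),
    [/\ in_regular_class Ebar Abar E A, in_class Bbar B, in_class Cbar C
      & forall K : 'M[R]_(p, m), satisfies_pattern Kbar K ->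
          (\rank (lambda *: cplx E - cplx A
                  - cplx B *m cplx K *m cplx C)%R < n)%N].

Definition has_SSSFM (R : realType) (n p m : nat)
    (Ebar Abar : 'M[symbol]_n) (Bbar : 'M[symbol]_(n, p))
    (Cbar : 'M[symbol]_(m, n)) (Kbar : 'M[symbol]_(p, m)) : Prop :=
  exists lambda : R[i], is_SSSFM Ebar Abar Bbar Cbar Kbar lambda.

Definition fed_sensors (p m : nat) (Kbar : 'M[symbol]_(p, m)) (i : 'I_p) :
    {set 'I_m} :=
  [set j | Kbar i j == Cross].

(* \mathcal J(I, Kbar): the union runs over the actuators outside I. *)
Definition sensors_off (p m : nat) (Kbar : 'M[symbol]_(p, m)) (I : {set 'I_p}) :
    {set 'I_m} :=
  \bigcup_(i in [set: 'I_p] :\: I) fed_sensors Kbar i.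

Definition cols_of (F : Type) (a b : nat) (I : {set 'I_b}) (X : 'M[F]_(a, b)) :
    'M[F]_(a, #|I|) :=
  colsub (fun k : 'I_#|I| => enum_val k) X.

Definition rows_of (F : Type) (a b : nat) (J : {set 'I_a}) (X : 'M[F]_(a, b)) :
    'M[F]_(#|J|, b) :=
  rowsub (fun k : 'I_#|J| => enum_val k) X.

(* Main.v *)
(** The closed-loop matrix is [M + \sum_i b_i w_i] with [w_i] ranging over the
span of the sensor rows fed to actuator [i], and its generic rank equals the
minimum over [I] of the rank of the block matrix. Actuators are assigned one by
one to [I] (append the column [b_t]) or to its complement (append the rows fed
to [t]), keeping the rank at most [r] for all admissible [K]. If both choices
failed for [t], a generic [K] would witness both failures at once: then some fed
row [c] lies outside the row space, and adding [b_t c] raises the rank above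
[r], a contradiction. *)
Require Import Defs.
From HB Require Import structures.
From mathcomp Require Import all_boot all_order all_algebra.
From mathcomp Require Import boolp reals complex.
From mathcomp Require Import zify ring.

Set Implicit Arguments.
Unset Strict Implicit.
Unset Printing Implicit Defensive.
Import Order.TTheory GRing.Theory Num.Theory.
Local Open Scope ring_scope.

(** * Ranks under rank-one updates and at generic points of a line *)

Lemma mxrank_ker_le (F : fieldType) (a b c : nat)
    (X : 'M[F]_(a, b)) (Y : 'M[F]_(a, c)) :
  (forall x : 'rV_a, x *m X = 0 -> x *m Y = 0) -> (\rank Y <= \rank X)%N.
Proof.
move=> XY.
have: (kermx X <= kermx Y)%MS.
  apply/row_subP => i; apply/sub_kermxP/XY/sub_kermxP; exact: row_sub.
move/mxrankS; rewrite !mxrank_ker.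
have := rank_leq_row X; have := rank_leq_row Y; lia.
Qed.

(** If the scalar [x *m u] were some nonzero [s], the equation would read [s *: v = - x *m X] and
    put [v] in the row space of [X]. *)
Lemma mul_rank1_update_eq0 (F : fieldType) (a b : nat) (X : 'M[F]_(a, b))
    (u : 'cV_a) (v : 'rV_b) (x : 'rV_a) :
  ~~ (v <= X)%MS -> x *m (X + u *m v) = 0 -> x *m X = 0 /\ x *m u = 0.
Proof.
rewrite mulmxDr mulmxA => vX.
rewrite [x *m u]mx11_scalar mul_scalar_mx; set s := (x *m u) 0 0 => xe.
have [s0|s0] := eqVneq s 0; first by move: xe; rewrite s0 scale0r addr0 raddf0.
case/negP: vX; rewrite -(eqmx_scale v s0).
rewrite -[s *: v](addKr (x *m X)) xe addr0 -mulNmx; exact: submxMl.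
Qed.

(** Multiplying by one-sided inverses of the factors of [X = col_base X *m row_base X] compresses
    [X] to an identity matrix of size [\rank X]. The polynomial [q] is the determinant of the
    compressed line, so [q.[0] = 1], and wherever [q] does not vanish the compression is invertible
    and bounds the rank from below. *)
Lemma mxrank_line_generic (F : fieldType) (a b : nat) (X D : 'M[F]_(a, b)) :
  exists2 q : {poly F}, q.[0] != 0 &
    forall t, q.[t] != 0 -> (\rank X <= \rank (X + t *: D)%R)%N.
Proof.
have /row_fullP[L LX] := col_base_full X.
have /row_freeP[Z XZ] := row_base_free X.
have LXZ : L *m X *m Z = 1%:M.
  rewrite -XZ -[row_base X]mul1mx -LX -[_ *m col_base X *m _]mulmxA.
  by rewrite mulmx_base.
pose q := \det (map_mx polyC (L *m X *m Z) + 'X *: map_mx polyC (L *m D *m Z)).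
have qE t : q.[t] = \det (L *m (X + t *: D) *m Z).
  rewrite -/(horner_eval t q) -det_map_mx; congr (\det _).
  rewrite mulmxDr mulmxDl -scalemxAr -scalemxAl.
  move: (L *m X *m Z) (L *m D *m Z) => P Q.
  by apply/matrixP=> i j; rewrite !mxE /= /horner_eval !hornerE.
exists q => [|t]; first by rewrite qE scale0r addr0 LXZ det1 oner_neq0.
have rk Y : (\rank (L *m Y *m Z) <= \rank Y)%N.
  exact: leq_trans (mxrankM_maxl _ _) (mxrankM_maxr _ _).
by rewrite qE => h; have := rk (X + t *: D); rewrite mxrank_unit ?unitmxE ?unitfE.
Qed.

(** The genericity polynomials have coefficients in [F], while gains must come from [R]. In
    characteristic 0 the images of the naturals below [size q] are distinct and too many to be all
    roots. *)
Lemma exists_nonroot (R : numFieldType) (F : fieldType)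
    (f : {rmorphism R -> F}) (q : {poly F}) :
  q != 0 -> exists s : R, q.[f s] != 0.
Proof.
move=> q0; pose rs := [seq f i%:R | i <- iota 0 (size q)].
have urs : uniq rs.
  rewrite map_inj_uniq ?iota_uniq // => i j /fmorph_inj/eqP.
  by rewrite eqr_nat => /eqP.
have [/(max_poly_roots q0)/(_ urs)|/allPn[_ /mapP[i _ ->] r]] :=
  boolP (all (root q) rs); last by exists i%:R.
by rewrite size_map size_iota ltnn.
Qed.

Lemma mul_cols_of_eq0 (F : fieldType) (c a b : nat) (I : {set 'I_b})
    (x : 'M[F]_(c, a)) (B : 'M[F]_(a, b)) :
  x *m cols_of I B = 0 <-> (forall i, i \in I -> x *m col i B = 0).
Proof.
split=> [xB i iI | xB].
  have -> : col i B = col (enum_rank_in iI i) (cols_of I B).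
    by apply/colP=> k; rewrite !mxE enum_rankK_in.
  by rewrite colE mulmxA xB mul0mx.
apply/matrixP=> k l; have /colP/(_ k) := xB _ (enum_valP l).
rewrite !mxE; apply: etrans; by apply: eq_bigr => ? _; rewrite !mxE.
Qed.

Lemma mul_cols_rows_of (F : fieldType) (a b c : nat) (I : {set 'I_b})
    (X : 'M[F]_(a, b)) (Y : 'M[F]_(b, c)) :
  (forall i k l, i \notin I -> X k i * Y i l = 0) ->
  cols_of I X *m rows_of I Y = X *m Y.
Proof.
move=> XY; apply/matrixP=> k l; rewrite !mxE.
rewrite [RHS](bigID (mem I)) /= [X in _ = _ + X]big1 ?addr0; last first.
  by move=> i /XY ->.
rewrite [RHS]big_enum_val; by apply: eq_bigr => i _; rewrite !mxE.
Qed.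

(** * Feedback with gains in [R] for a system over [F] *)

Section DecentralizedRank.

Variables (R : numFieldType) (F : fieldType) (f : {rmorphism R -> F}).
Variables (n p m : nat) (B : 'M[F]_(n, p)) (C : 'M[F]_(m, n)).
Variable J : 'I_p -> {set 'I_m}.

(** A partial assignment: actuators in [I] contribute columns, those in [O] contribute the rows fed
    to them, and undecided ones act only through a feedback term placed in [N]. *)
Let sysmx (N : 'M[F]_n) (I O : {set 'I_p}) :=
  block_mx N (cols_of I B) (rows_of (\bigcup_(i in O) J i) C) 0.

Let fb (K : 'M[R]_(p, m)) := B *m map_mx f K *m C.

(** Split the gain by rows: the rows in [I] reach [M] through the columns [cols_of I B], the others
    only through sensor rows fed to actuators outside [I]. Hence [M + fb K] is the block matrix
    multiplied on both sides. *)
Lemma mxrank_feedback_le (M : 'M[F]_n) (I : {set 'I_p}) (K : 'M[R]_(p, m)) :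
    (forall i j, j \notin J i -> K i j = 0) ->
  (\rank (M + fb K)%R <= \rank (sysmx M I (~: I))%R)%N.
Proof.
move=> KJ; pose S := \bigcup_(i in ~: I) J i.
pose K1 := \matrix_(i, j) (if i \in I then f (K i j) else 0).
pose K2 := \matrix_(i, j) (if i \in I then 0 else f (K i j)).
have KE : map_mx f K = K1 + K2.
  by apply/matrixP=> i j; rewrite !mxE; case: ifP; rewrite ?addr0 ?add0r.
have K1E : cols_of I B *m rows_of I K1 = B *m K1.
  by apply: mul_cols_rows_of => i k l /negbTE iI; rewrite !mxE iI mulr0.
have K2E : cols_of S (B *m K2) *m rows_of S C = B *m K2 *m C.
  apply: mul_cols_rows_of => j k l jS.
  rewrite mxE big1 ?mul0r // => i _; rewrite !mxE.
  case: ifPn => iI; rewrite ?mulr0 // KJ ?rmorph0 ?mulr0 //.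
  by apply: contra jS => jJ; apply/bigcupP; exists i; rewrite ?inE.
have -> : M + fb K = row_mx 1%:M (cols_of S (B *m K2)) *m sysmx M I (~: I)
    *m col_mx 1%:M (rows_of I K1 *m C).
  rewrite mul_row_block mul_row_col !mul1mx mulmx0 addr0 mulmx1 K2E mulmxA K1E.
  by rewrite /fb KE mulmxDr mulmxDl -addrA [X in _ + X]addrC.
exact: leq_trans (mxrankM_maxl _ _) (mxrankM_maxr _ _).
Qed.

Lemma sysmx_line (M : 'M[F]_n) (K1 K2 : 'M[R]_(p, m)) (s : R)
    (I O : {set 'I_p}) :
  sysmx (M + fb (K1 + s *: (K2 - K1))) I O =
  sysmx (M + fb K1) I O + f s *: block_mx (fb (K2 - K1)) 0 0 0.
Proof.
rewrite /sysmx scale_block_mx add_block_mx !scaler0 !addr0 -addrA.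
congr (block_mx (M + _) _ _ _).
by rewrite /fb map_mxD map_mxZ mulmxDr mulmxDl -scalemxAr -scalemxAl.
Qed.

(** Both rank bounds hold at generic points of the line through [K1] and [K2], so one point serves
    for both. *)
Lemma mxrank_sysmx_common (M : 'M[F]_n) (K1 K2 : 'M[R]_(p, m))
    (I1 O1 I2 O2 : {set 'I_p}) :
  exists s : R, let K := K1 + s *: (K2 - K1) in
    (\rank (sysmx (M + fb K1) I1 O1)%R <= \rank (sysmx (M + fb K) I1 O1)%R)%N /\
    (\rank (sysmx (M + fb K2) I2 O2)%R <= \rank (sysmx (M + fb K) I2 O2)%R)%N.
Proof.
have [q1 q10 q1P] := mxrank_line_generic
  (sysmx (M + fb K1) I1 O1) (block_mx (fb (K2 - K1)) 0 0 0).
have [q2 q20 q2P] := mxrank_line_generic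
  (sysmx (M + fb K2) I2 O2) (block_mx (fb (K1 - K2)) 0 0 0).
(* The second line starts at [K2], so its parameter is [1 - s]; evaluating the composition at 1
   recovers [q2.[0]]. *)
have q0 : q1 * (q2 \Po (1 - 'X)) != 0.
  rewrite mulf_neq0 //.
    by apply: contraNneq q10 => ->; rewrite horner0.
  apply: contraNneq q20 => e; have := horner_comp q2 (1 - 'X) 1.
  by rewrite e !hornerE subrr => <-.
have [s] := exists_nonroot f q0.
rewrite hornerM horner_comp !hornerE mulf_eq0 negb_or => /andP[s1 s2].
exists s; split; first by rewrite sysmx_line q1P.
have -> : K1 + s *: (K2 - K1) = K2 + (1 - s) *: (K1 - K2).
  by apply/matrixP=> i j; rewrite !mxE; ring.
by rewrite sysmx_line q2P // rmorphB rmorph1.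
Qed.

(** A unit gain from sensor [j] to actuator [t] is a rank-one update by a row outside the row space.
    The left kernel of the updated matrix therefore annihilates both the old matrix and column [t]
    of [B]. *)
Lemma mxrank_sysmx_extend (M : 'M[F]_n) (I O : {set 'I_p}) (t : 'I_p)
    (j : 'I_m) (K : 'M[R]_(p, m)) :
    ~~ (row_mx (row j C) 0 <= sysmx (M + fb K)%R I O)%MS ->
  (\rank (sysmx (M + fb K) (t |: I) O)%R
     <= \rank (sysmx (M + fb (K + delta_mx t j)) I O)%R)%N.
Proof.
move=> jX.
have -> : sysmx (M + fb (K + delta_mx t j)) I O =
    sysmx (M + fb K) I O + col_mx (col t B) 0 *m row_mx (row j C) 0.
  rewrite mul_col_row /sysmx add_block_mx !mul0mx !mulmx0 !addr0 -addrA.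
  congr (block_mx (M + _) _ _ _).
  rewrite /fb map_mxD map_delta_mx mulmxDr mulmxDl; congr (_ + _).
  by rewrite -(mul_delta_mx (0 : 'I_1)) mulmxA -colE -mulmxA -rowE.
apply: mxrank_ker_le => x /(mul_rank1_update_eq0 jX)[].
rewrite -[x]hsubmxK !mul_row_block mul_row_col !mulmx0 !addr0.
rewrite -row_mx0 => /eq_row_mx[e1 /mul_cols_of_eq0 e2] e3.
rewrite e1; have -> : lsubmx x *m cols_of (t |: I) B = 0; last by rewrite row_mx0.
apply/mul_cols_of_eq0 => i; rewrite !inE => /orP[/eqP->//|]; exact: e2.
Qed.

Lemma sysmx_fed_sub (N : 'M[F]_n) (I O : {set 'I_p}) (t : 'I_p) :
    (forall j, j \in J t -> (row_mx (row j C) 0 <= sysmx N I O)%MS) ->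
  (sysmx N I (t |: O) <= sysmx N I O)%MS.
Proof.
have NX : (row_mx N (cols_of I B) <= sysmx N I O)%MS.
  by rewrite /sysmx block_mxEv -addsmxE addsmxSl.
have CX j : j \in \bigcup_(i in O) J i ->
    (row_mx (row j C) 0 <= sysmx N I O)%MS.
  move=> jO; have -> : row_mx (row j C) 0 =
      row (rshift n (enum_rank_in jO j)) (sysmx N I O); last exact: row_sub.
  rewrite /sysmx block_mxEv rowKd row_row_mx row0; congr row_mx.
  by apply/rowP=> k; rewrite !mxE enum_rankK_in.
move=> jX; rewrite {1}/sysmx block_mxEv col_mx_sub NX /=.
apply/row_subP=> k; rewrite row_row_mx row0.
have -> : row k (rows_of (\bigcup_(i in t |: O) J i) C) = row (enum_val k) C.
  by apply/rowP=> l; rewrite !mxE.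
have : enum_val k \in \bigcup_(i in t |: O) J i := enum_valP k.
case/bigcupP=> i; rewrite !inE => /orP[/eqP->|iO] ji.
  exact: jX.
by apply: CX; apply/bigcupP; exists i.
Qed.

(** Induction on the number of undecided actuators, which are the only ones where [K] may be
    nonzero. Once none is left, [K = 0] and [O] is exactly the complement of [I]. *)
Lemma decentralized_rank_assign (M : 'M[F]_n) (r : nat) (I O : {set 'I_p}) :
    O \subset ~: I ->
    (forall K : 'M[R]_(p, m),
       (forall i j, (i \in I :|: O) || (j \notin J i) -> K i j = 0) ->
       (\rank (sysmx (M + fb K) I O)%R <= r)%N) ->
  exists I', (\rank (sysmx M I' (~: I')) <= r)%N.
Proof.
have [k] := ubnP #|~: (I :|: O)|; elim: k I O => // k IHk I O le_k OI rkK.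
have [e|[t tIO]] := set_0Vmem (~: (I :|: O)).
  have -> : M = M + fb 0 by rewrite /fb map_mx0 mulmx0 mul0mx addr0.
  exists I; have <- : O = ~: I.
    apply/eqP; rewrite eqEsubset OI; apply/subsetP=> i.
    by have /setP/(_ i) := e; rewrite !inE; case: (i \in I); case: (i \in O).
  by apply: rkK => i j _; rewrite mxE.
have [tI tO] : t \notin I /\ t \notin O.
  by apply/andP; rewrite -negb_or -in_setU -in_setC.
have lt_k (S : {set 'I_p}) : S = ~: (I :|: O) :\ t -> (#|S| < k)%N.
  by move=> ->; move: le_k; rewrite (cardsD1 t (~: _)) tIO; lia.
pose bounded I1 O1 := forall K : 'M[R]_(p, m),
  (forall i j, (i \in I1 :|: O1) || (j \notin J i) -> K i j = 0) ->
  (\rank (sysmx (M + fb K) I1 O1)%R <= r)%N.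
have unbounded I1 O1 : I1 :|: O1 = t |: (I :|: O) -> ~ bounded I1 O1 ->
    exists2 K : 'M[R]_(p, m),
      (forall i j, (i \in t |: (I :|: O)) || (j \notin J i) -> K i j = 0) &
      (r < \rank (sysmx (M + fb K) I1 O1)%R)%N.
  move=> <- /existsNP[K /not_implyP[KJ /negP]]; rewrite -ltnNge => rK.
  by exists K.
have eI : (t |: I) :|: O = t |: (I :|: O) by rewrite setUA.
have eO : I :|: (t |: O) = t |: (I :|: O) by rewrite setUCA.
have [bI|/(unbounded _ _ eI)[K1 K1J rK1]] := pselect (bounded (t |: I) O).
  apply: (IHk _ _ _ _ bI); first by apply: lt_k; rewrite eI setCU setIC -setDE.
  apply/subsetP=> i iO; have := subsetP OI i iO; rewrite !inE negb_or => ->.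
  by rewrite andbT; apply: contraNneq tO => <-.
have [bO|/(unbounded _ _ eO)[K2 K2J rK2]] := pselect (bounded I (t |: O)).
  apply: (IHk _ _ _ _ bO); first by apply: lt_k; rewrite eO setCU setIC -setDE.
  by rewrite subUset OI sub1set inE tI.
have [s /= [/(leq_trans rK1) + /(leq_trans rK2)]] :=
  mxrank_sysmx_common M K1 K2 (t |: I) O I (t |: O).
set K := K1 + _ => rI rO.
have KJ i j : (i \in t |: (I :|: O)) || (j \notin J i) -> K i j = 0.
  by move=> ij; rewrite !mxE K1J // K2J // subr0 mulr0 addr0.
(* [K] vanishes on row [t] as well, so it is admissible for the current assignment. *)
have rK : (\rank (sysmx (M + fb K) I O)%R <= r)%N.
  by apply: rkK => i j /orP[] ij; apply: KJ; rewrite ?ij ?orbT // in_setU ij orbT.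
(* If all rows fed to [t] already lay in the row space, appending them would keep the rank at most
   [r], against [rO]. *)
have [|/existsNP[j /not_implyP[jt /negP jX]]] := pselect (forall j, j \in J t ->
    (row_mx (row j C) 0 <= sysmx (M + fb K)%R I O)%MS).
  move=> /sysmx_fed_sub/mxrankS rX.
  by have := leq_trans rO (leq_trans rX rK); rewrite ltnn.
(* The gain [K + delta_mx t j] is still admissible, since [t] is undecided and [j] is fed to it, yet
   its rank exceeds [r]. *)
have := leq_trans rI (mxrank_sysmx_extend t jX).
rewrite ltnNge rkK // => i l il; rewrite [LHS]mxE KJ; last first.
  by case/orP: il => il; rewrite ?il ?orbT // in_setU il orbT.
rewrite mxE add0r; case: eqP => [ei|] //=; case: eqP => [el|] //=.
by move: il; rewrite ei el jt orbF inE (negbTE tI) (negbTE tO).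
Qed.

Theorem decentralized_rank (M : 'M[F]_n) (r : nat) :
  (forall K : 'M[R]_(p, m), (forall i j, j \notin J i -> K i j = 0) ->
     (\rank (M + B *m map_mx f K *m C)%R <= r)%N) <->
  exists I : {set 'I_p}, (\rank (block_mx M (cols_of I B)
    (rows_of (\bigcup_(i in ~: I) J i) C) 0) <= r)%N.
Proof.
split=> [rM|[I rI] K KJ]; last exact: leq_trans (mxrank_feedback_le M I KJ) rI.
apply: (@decentralized_rank_assign M r set0 set0); rewrite ?sub0set // => K KJ.
have KJ' i j : j \notin J i -> K i j = 0 by move=> ij; rewrite KJ ?ij ?orbT.
apply: leq_trans (rM K KJ').
(* The borders are empty, but their size [#|set0|] is not literally 0; a factorization through
   [M + fb K] avoids a cast. *)
have -> : sysmx (M + fb K) set0 set0 =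
    col_mx 1%:M 0 *m (M + fb K) *m row_mx 1%:M 0.
  rewrite mul_col_mx mul1mx mul0mx mul_col_row mulmx1 !mulmx0 mul0mx /sysmx.
  congr (block_mx _ _ _ _); apply/matrixP=> i j.
    by have := enum_valP j; rewrite inE.
  have : enum_val i \in \bigcup_(l in set0) J l := enum_valP i.
  by case/bigcupP=> l; rewrite inE.
exact: leq_trans (mxrankM_maxl _ _) (mxrankM_maxr _ _).
Qed.

End DecentralizedRank.

(** * Specialization to real gains and complex pencils *)

Theorem proposition1 (R : realType) (n p m : nat)
    (Ebar Abar : 'M[symbol]_n) (Bbar : 'M[symbol]_(n, p))
    (Cbar : 'M[symbol]_(m, n)) (Kbar : 'M[symbol]_(p, m))
    (hK : information_pattern Kbar) :
  has_SSSFM R Ebar Abar Bbar Cbar Kbar <->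
  exists (E A : 'M[R]_n) (B : 'M[R]_(n, p)) (C : 'M[R]_(m, n))
         (K : 'M[R]_(p, m)) (I : {set 'I_p}) (lambda : R[i]),
    [/\ in_regular_class Ebar Abar E A, in_class Bbar B, in_class Cbar C,
        in_class Kbar K
      & (\rank (block_mx
                  (cplx A - lambda *: cplx E) (cols_of I (cplx B))
                  (rows_of (sensors_off Kbar I) (cplx C)) 0)%R < n)%N].
Proof.
have patternE (K : 'M[R]_(p, m)) : satisfies_pattern Kbar K <->
    (forall i j, j \notin fed_sensors Kbar i -> K i j = 0).
  split=> KJ i j.
    rewrite inE => ij; apply: KJ; move: (hK i j) ij.
    by rewrite !inE => /orP[] /eqP ->.
  by move=> ij; apply: KJ; rewrite inE ij.
have rankE (E A : 'M[R]_n) B (C : 'M[R]_(m, n)) lambda :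
    (forall K, satisfies_pattern Kbar K ->
       (\rank (lambda *: cplx E - cplx A
               - cplx B *m cplx K *m cplx C)%R < n)%N) <->
    exists I : {set 'I_p}, (\rank (block_mx
        (cplx A - lambda *: cplx E) (cols_of I (cplx B))
        (rows_of (sensors_off Kbar I) (cplx C)) 0)%R < n)%N.
  (* The two conventions for the closed loop differ by a sign, which the rank ignores. *)
  have rkN K : \rank (lambda *: cplx E - cplx A - cplx B *m cplx K *m cplx C)%R
      = \rank (cplx A - lambda *: cplx E + cplx B *m cplx K *m cplx C)%R.
    by rewrite -mxrank_opp opprD opprK opprB.
  (* For [n = 0] the bound [n.-1] would not express [< n]. Here both sides are false, the left one
     because [K = 0] satisfies the pattern. *)
  have [n0|n0] := posnP n.
    have ltn k : (k < n)%N = false by rewrite n0.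
    split=> [/(_ 0)|[I]]; rewrite ltn // => nosat.
    by case: notF; apply: nosat => i j _; rewrite mxE.
  have ltnE k : (k < n)%N = (k <= n.-1)%N by lia.
  have [h1 h2] := decentralized_rank (real_complex R) (cplx B) (cplx C)
    (fed_sensors Kbar) (cplx A - lambda *: cplx E) n.-1.
  split=> [rk|[I]].
    have [|I rI] := h1; last by exists I; rewrite ltnE /sensors_off setTD.
    by move=> K /patternE KJ; rewrite -ltnE -rkN rk.
  rewrite ltnE /sensors_off setTD => rI K /patternE KJ.
  by rewrite rkN ltnE; apply: h2 KJ; exists I.
split=> [[lambda [E [A [B [C [hEA hB hC /rankE[I rI]]]]]]]|].
  (* The 0-1 matrix of the pattern is a member of its class. *)
  exists E, A, B, C, (\matrix_(i, j) (Kbar i j != Zero)%:R), I, lambda.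
  split=> // i j; rewrite mxE; case: (Kbar i j) => //=; exact/eqP/oner_neq0.
move=> [E [A [B [C [_ [I [lambda [hEA hB hC _ rI]]]]]]]].
by exists lambda, E, A, B, C; split=> //; apply/rankE; exists I.
Qed.
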